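(* Let $1\le k\le n$ be integers, $\delta\in(0,1)$, and let $\xi$ be an integer with $\xi\ge\frac{2(k+1)!}{\delta^2}\ln n$. Let $S$ be a multiset of $\xi$ permutations of $[n]$, each drawn independently and uniformly at random. Then with probability at least $1-\frac1n$, the uniform distribution over $S$ satisfies the $(k,\delta)$-uniform-induced-ordering property.
   Context: $(k,\delta)$-uniform-induced-ordering property of a distribution over permutations $\pi$ of $[n]$ (where $\pi(i)$ is the position of item $i$): for every $k$ distinct items $y_1,\dots,y_k\in[n]$, $\Pr[\pi(y_1)<\dots<\pi(y_k)]\ge(1-\delta)/k!$. *)

(* Defs.v *)
From HB Require Import structures.
From mathcomp Require Import all_boot all_order all_algebra all_fingroup.
From mathcomp Require Import all_classical all_reals all_analysis.

Set Implicit Arguments.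
Unset Strict Implicit.
Unset Printing Implicit Defensive.

Import Order.TTheory GRing.Theory Num.Theory.

Local Open Scope classical_set_scope.
Local Open Scope ring_scope.

HB.instance Definition _ (T : finType) :=
  isPointed.Build (perm_type T) (perm_one T).
HB.instance Definition _ (T : finType) :=
  @isMeasurable.Build default_measure_display (perm_type T)
    discrete_measurable discrete_measurable0
    (@discrete_measurableC _) (@discrete_measurableU _).

(* Every measurable set of values is tested, and the product rule is required
   on every subfamily J: this is mutual, not just pairwise, independence. *)
Definition mutually_independent (R : realType) (d d' : measure_display)
    (T : measurableType d) (T' : measurableType d') (P : probability T R)
    (I : finType) (X : I -> {RV P >-> T'}) : Prop :=
  forall (J : {set I}) (A : I -> set T'), (forall i, measurable (A i)) ->
    P (\big[setI/setT]_(i in J) (X i @^-1` A i)) =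
    (\prod_(i in J) P (X i @^-1` A i))%E.

Definition uniform_perm (R : realType) (d : measure_display)
    (T : measurableType d) (P : probability T R) (n : nat)
    (X : {RV P >-> 'S_n}) : Prop :=
  forall p : 'S_n, distribution P X [set p] = ((#|{: 'S_n}|%:R)^-1)%:E.

(* Distributions on the finite set 'S_n are given by their mass function.  The
   multiset S is a list up to reordering; repetitions count with multiplicity,
   and S = [::] yields the zero function. *)
Definition unif_over (R : realType) (n : nat) (S : seq 'S_n) (p : 'S_n) : R :=
  (count_mem p S)%:R / (size S)%:R.

Lemma unif_over_ge0 (R : realType) (n : nat) (S : seq 'S_n) (p : 'S_n) :
  0 <= unif_over R S p.
Proof. by rewrite /unif_over divr_ge0. Qed.

Lemma unif_over_sum1 (R : realType) (n : nat) (S : seq 'S_n) :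
  (0 < size S)%N -> \sum_(p : 'S_n) unif_over R S p = 1.
Proof.
move=> S0; rewrite /unif_over -mulr_suml -natr_sum.
have -> : (\sum_(p : 'S_n) count_mem p S = size S)%N.
  rewrite -sum1_size [RHS](partition_big id xpredT) //=.
  by apply: eq_bigr => p _; rewrite -sum1_count.
by rewrite divff // pnatr_eq0 -lt0n.
Qed.

Definition prob_of (R : realType) (n : nat) (D : 'S_n -> R)
    (E : pred 'S_n) : R :=
  \sum_(p : 'S_n | E p) D p.

(* p x is the position of item x in the permutation p. *)
Definition induces_order (n k : nat) (y : 'I_k -> 'I_n) : pred 'S_n :=
  fun p => [forall i : 'I_k, forall j : 'I_k,
    (i < j)%N ==> (p (y i) < p (y j))%N].

Definition uniform_induced_ordering (R : realType) (n k : nat) (delta : R)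
    (D : 'S_n -> R) : Prop :=
  forall y : 'I_k -> 'I_n, injective y ->
    (1 - delta) / (k`!)%:R <= prob_of D (induces_order y).

(* Main.v *)
(* Fix distinct items y_1, ..., y_k.  Relabelling the items by permutations of
   {y_1, ..., y_k} shows that a uniform permutation puts them in this order with
   probability at least 1/k!.  The lower Chernoff bound, obtained from the
   exponential moment at t = delta and e^-t <= 1 - t + t^2/2, then bounds the
   probability that fewer than (1 - delta) xi / k! of the samples do so by
   exp(- delta^2 xi / (2 k!)) <= n^-(k+1), and a union bound over the at most n^k
   choices of y concludes.  Since the samples are i.i.d. uniform, their joint law
   is uniform on the functions 'I_xi -> 'S_n, so all of this is counting. *)

Require Import Defs.
From mathcomp Require Import all_boot all_order all_algebra all_fingroup.
From mathcomp Require Import ring lra.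
From mathcomp Require Import all_classical all_reals all_analysis.
Import Order.TTheory GRing.Theory Num.Theory.

Local Open Scope classical_set_scope.
Local Open Scope ring_scope.

(** * Permutations inducing a given order *)

(** The map sends [y i] to [y (s i)] and fixes every point off the range of [y]. It turns a
    permutation of indices into a relabelling of items. *)
Lemma exists_perm_comp (T : finType) (k : nat) (y : 'I_k -> T) (s : 'S_k) :
  injective y -> exists t : {perm T}, forall i, t (y i) = y (s i).
Proof.
move=> yinj.
pose f x := if [pick i | y i == x] is Some i then y (s i) else x.
have fy i : f (y i) = y (s i).
  rewrite /f; case: pickP => [j /eqP/yinj ->//|/(_ i)].
  by rewrite eqxx.
have fN x : (forall i, y i != x) -> f x = x.
  by rewrite /f; case: pickP => // i /eqP yi /(_ i); rewrite yi eqxx.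
have im x : (exists i, y i = x) \/ (forall i, y i != x).
  have [/existsP[i /eqP yi]|/existsPn yN] := boolP [exists i, y i == x].
  - by left; exists i.
  - by right.
have finj : injective f.
  move=> x x'; have [[i <-]|xN] := im x; have [[i' <-]|xN'] := im x'.
  - by rewrite !fy => /yinj/perm_inj ->.
  - by rewrite fy fN// => /eqP; rewrite (negbTE (xN' _)).
  - by rewrite fy fN// => /esym/eqP; rewrite (negbTE (xN _)).
  - by rewrite !fN.
by exists (perm finj) => i; rewrite permE.
Qed.

(** The rank [r i], the number of values of [q] below [q i], is injective in [i], hence a
    permutation of ['I_k]. Its inverse sorts [q]. *)
Lemma exists_sorting_perm (n k : nat) (q : 'I_k -> 'I_n) : injective q ->
  exists s : 'S_k, forall i j : 'I_k, (i < j)%N -> (q (s i) < q (s j))%N.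
Proof.
move=> qinj.
pose r i := #|[set j | (q j < q i)%N]%SET|.
have rmono i j : (q i < q j)%N -> (r i < r j)%N.
  move=> qij; apply: proper_card; apply/properP; split.
    by apply/fintype.subsetP => l; rewrite !inE => /ltn_trans; apply.
  by exists i; rewrite !inE ?ltnn.
have rk i : (r i < k)%N.
  rewrite -[X in (_ < X)%N]card_ord -cardsT; apply: proper_card.
  apply/properP; split; first exact: finset.subsetT.
  by exists i; rewrite !inE// ltnn.
have rinj : injective (fun i => Ordinal (rk i)).
  move=> i j [rij]; apply/qinj/val_inj.
  by case: (ltngtP (q i) (q j)) => // /rmono; rewrite rij ltnn.
exists (perm rinj)^-1%g => i j ij.
rewrite ltnNge leq_eqVlt; apply/negP => /orP[/eqP/val_inj/qinj/perm_inj ji|].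
  by rewrite ji ltnn in ij.
move=> /rmono; apply/negP; rewrite -leqNgt.
have rE l : r ((perm rinj)^-1%g l) = l.
  by have := permKV (perm rinj) l; rewrite permE => /(congr1 val).
by rewrite !rE ltnW.
Qed.

(** The k! sets [induces_order (y \o s)] have equal size, and together they cover ['S_n], since some
    [s] sorts the positions of the items under any given permutation. *)
Lemma card_induces_order (n k : nat) (y : 'I_k -> 'I_n) : injective y ->
  (#|{: 'S_n}| <= k`! * #|induces_order y|)%N.
Proof.
move=> yinj.
have cardE (s : 'S_k) : #|induces_order (y \o s)| = #|induces_order y|.
  have [t tE] := @exists_perm_comp _ _ y s yinj.
  (* Since [(t * p) x = p (t x)], left multiplication by [t] relabels the items before their
     positions are read. *)
  rewrite -(card_imset (mem (induces_order (y \o s))) (mulgI t)).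
  apply: eq_card => p; apply/imsetP/idP => [[p' p'E ->]|pE].
    apply/'forall_forallP => i j; apply/implyP => ij; rewrite !permM !tE.
    by have /'forall_forallP/(_ i j)/implyP/(_ ij) := p'E.
  exists (t^-1 * p)%g; last by rewrite mulgA mulgV mul1g.
  apply/'forall_forallP => i j; apply/implyP => ij.
  rewrite !permM /= -!tE !permK.
  by have /'forall_forallP/(_ i j)/implyP/(_ ij) := pE.
have -> : (k`! * #|induces_order y| =
    \sum_(s : 'S_k) #|induces_order (y \o s)|)%N.
  by under eq_bigr do rewrite cardE; rewrite sum_nat_const card_Sn.
under eq_bigr do rewrite -sum1_card.
rewrite (exchange_big_dep xpredT)//= -sum1_card leq_sum// => p _.
have [s sE] := @exists_sorting_perm _ _ (p \o y) (inj_comp perm_inj yinj).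
rewrite (bigD1 s)//=; apply/'forall_forallP => i j; apply/implyP.
exact: sE.
Qed.

(** * Lower-tail Chernoff bound *)

(** The difference of the two sides vanishes at 0 and has derivative x - 1 + e^-x, which is
    nonnegative; the mean value theorem concludes. *)
Lemma expRN_le (R : realType) (t : R) : 0 <= t ->
  expR (- t) <= 1 - t + t ^+ 2 / 2.
Proof.
move=> t0.
pose f (x : R) := 1 - x + x ^+ 2 / 2 - expR (- x).
have df (x : R) : is_derive x 1 f (x - 1 + expR (- x)).
  by apply: is_derive_eq; rewrite /GRing.scale /=; field.
have cf : {within `[0, t], continuous f}.
  apply: continuous_subspaceT => x.
  by apply/differentiable_continuous/derivable1_diffP; case: (df x).
have [c _] := MVT_segment t0 (fun x _ => df x) cf.
have f0 : f 0 = 0 by rewrite /f oppr0 expR0; field.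
rewrite f0 !subr0 => fE; have c1 := expR_ge1Dx (- c).
have : 0 <= f t by rewrite fE mulr_ge0//; lra.
by rewrite /f; lra.
Qed.

Lemma chernoff_lower_tail_card (R : realType) (T : finType) (E : pred T)
    (m : nat) (q delta : R) : 0 <= q -> 0 <= delta <= 1 ->
  q * #|T|%:R <= #|E|%:R ->
  #|[set f : {ffun 'I_m -> T} |
      (#|[pred i | E (f i)]|)%:R <= (1 - delta) * q * m%:R]%SET|%:R
    <= #|T|%:R ^+ m * expR (- (delta ^+ 2 * q * m%:R / 2)).
Proof.
move=> q0 /andP[d0 d1] qE.
set a := (1 - delta) * q * m%:R; set B := [set f | _]%SET.
(* Markov's inequality: the indicator of [B] is at most exp(delta (a - number of hits)), and the sum
   of this over all tuples factorises over coordinates. *)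
have step1 : #|B|%:R <= expR (delta * a) *
    \prod_(i < m) \sum_(x : T) expR (- (delta * (E x)%:R)).
  rewrite bigA_distr_bigA mulr_sumr/= -sum1_card natr_sum.
  rewrite [leLHS]big_mkcond/=; apply: ler_sum => f _.
  rewrite -expR_sum -expRD; case: ifPn => [|_]; last exact: expR_ge0.
  rewrite inE => fB; rewrite -[leLHS]expR0 ler_expR sumrN -mulr_sumr -mulrBr mulr_ge0//.
  rewrite subr_ge0 (le_trans _ fB)// -natr_sum ler_nat.
  by rewrite -sum1_card [leqRHS]big_mkcond/=; apply: leq_sum => i _;
    rewrite inE; case: (E _).
(* One coordinate sums to |T| - |E| (1 - e^-delta). The bounds on e^-delta and |E|, then 1 + u <=
   e^u, finish. *)
have step2 : \sum_(x : T) expR (- (delta * (E x)%:R)) <=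
    #|T|%:R * expR (- (q * (delta - delta ^+ 2 / 2))).
  have -> : \sum_(x : T) expR (- (delta * (E x)%:R)) =
      #|T|%:R - #|E|%:R * (1 - expR (- delta)).
    have -> : #|E|%:R = \sum_(x : T) (E x)%:R :> R.
      by rewrite -natr_sum -sum1_card big_mkcond.
    rewrite -sum1_card natr_sum mulr_suml -sumrB; apply: eq_bigr => x _.
    case: (E x) => /=; first by rewrite mulr1; ring.
    by rewrite mulr0 oppr0 expR0; ring.
  have e1 := expRN_le _ _ d0.
  have e2 := expR_ge1Dx (- (q * (delta - delta ^+ 2 / 2))).
  have dd : 0 <= delta - delta ^+ 2 / 2 by nra.
  have : (q * #|T|%:R) * (delta - delta ^+ 2 / 2) <=
      #|E|%:R * (1 - expR (- delta)).
    by apply: ler_pM => //; [exact: mulr_ge0|lra].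
  have : #|T|%:R * (1 + - (q * (delta - delta ^+ 2 / 2))) <=
      #|T|%:R * expR (- (q * (delta - delta ^+ 2 / 2))) by exact: ler_wpM2l.
  lra.
apply: (le_trans step1); rewrite prodr_const card_ord.
apply: (@le_trans _ _ (expR (delta * a) *
  (#|T|%:R * expR (- (q * (delta - delta ^+ 2 / 2)))) ^+ m)).
  rewrite ler_wpM2l ?expR_ge0//; apply: lerXn2r => //; rewrite nnegrE.
  - by apply: sumr_ge0 => x _; exact: expR_ge0.
  - by rewrite mulr_ge0 ?expR_ge0.
rewrite exprMn mulrCA ler_wpM2l ?exprn_ge0// -expRM_natl -expRD ler_expR.
by rewrite le_eqVlt; apply/orP; left; apply/eqP; rewrite /a; field.
Qed.

(** * From samples to counting *)

(** The event splits into the disjoint fibres [A f], [f] in [G]. Independence over the full index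
    set gives each fibre the same probability. *)
Lemma iid_uniform_perm_event (R : realType) (n m : nat) (d : measure_display)
    (T : measurableType d) (P : probability T R) (X : 'I_m -> {RV P >-> 'S_n})
    (G : {set {ffun 'I_m -> 'S_n}}) :
  (forall i, uniform_perm (X i)) -> mutually_independent X ->
  P [set w | [ffun i => X i w] \in G] =
    (#|G|%:R / #|{: 'S_n}|%:R ^+ m)%:E.
Proof.
move=> Xunif Xind.
pose A (f : {ffun 'I_m -> 'S_n}) : set T :=
  \big[setI/setT]_(i in finset.setTfor 'I_m) (X i @^-1` [set f i]).
have AE f w : A f w <-> [ffun i => X i w] = f.
  rewrite /A -bigcap_seq_cond/=; split => [Aw|<- i _].
    by apply/ffunP => i; rewrite ffunE; apply: Aw; rewrite /= mem_index_enum inE.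
  by rewrite /= ffunE.
have -> : [set w | [ffun i => X i w] \in G] = \bigcup_(f in [set` G]) A f.
  apply/seteqP; split=> w /=; first by move=> wG; exists [ffun i => X i w] => //; exact/AE.
  by move=> [f fG /AE ->].
have mX i (f : {ffun 'I_m -> 'S_n}) : measurable (X i @^-1` [set f i]).
  by rewrite -[X in measurable X]setTI; exact: measurable_funPT.
rewrite measure_fin_bigcup//=; last 2 first.
- by move=> f g _ _ [w [/AE <- /AE <-]].
- by move=> f _; apply: bigsetI_measurable => i _; exact: mX.
rewrite (eq_fsbigr (fun=> ((#|{: 'S_n}|%:R ^+ m)^-1)%:E)); last first.
  move=> f _; rewrite /A (Xind _ (fun i => [set f i]))//.
  transitivity (\prod_(i in finset.setTfor 'I_m) (#|{: 'S_n}|%:R^-1 : R)%:E)%E.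
    by apply: eq_bigr => i _; exact: (Xunif i (f i)).
  by rewrite prodEFin prodr_const cardsT card_ord exprVn.
rewrite (fsbigE (enum G)) ?enum_uniq//; last first.
  by move=> f /= fG; rewrite mem_enum fG.
  by move=> f /=; rewrite mem_enum.
rewrite big_enum_cond/=.
rewrite (eq_bigl (mem G)); last first.
  by move=> f; rewrite mem_setE andbb.
by rewrite sumEFin sumr_const mulr_natl.
Qed.

(** Double counting of the pairs (p, i) with [g i = p] and [E p]. *)
Lemma prob_of_unif_over (R : realType) (n m : nat) (g : 'I_m -> 'S_n)
    (E : pred 'S_n) :
  prob_of (unif_over R [seq g i | i : 'I_m]) E =
    #|[pred i | E (g i)]|%:R / m%:R.
Proof.
rewrite /prob_of /unif_over size_image card_ord -mulr_suml -natr_sum.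
congr (_%:R / _); under eq_bigr do rewrite -sum1_count.
rewrite (exchange_big_dep xpredT)//= big_image/= -sum1_card [RHS]big_mkcond/=.
apply: eq_bigr => i _; rewrite inE; have [Ei|Ei] := boolP (E (g i)).
  rewrite (big_pred1 (g i))// => p.
  by rewrite /= eq_sym; case: eqP => [->|]; rewrite ?Ei ?andbF.
by rewrite big_pred0// => p; case: eqP => [<-|]; rewrite ?(negbTE Ei) ?andbF.
Qed.

(** * Union bound and conclusion *)

Lemma card_not_uniform_induced_ordering (R : realType) (k n m : nat)
    (delta : R) : (0 < n)%N -> 0 < delta < 1 ->
  2 * ((k.+1)`!)%:R / delta ^+ 2 * ln (n%:R : R) <= m%:R ->
  #|[set f : {ffun 'I_m -> 'S_n} | ~~ `[< uniform_induced_ordering k delta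
      (unif_over R [seq f i | i : 'I_m]) >]]%SET|%:R
    <= #|{: 'S_n}|%:R ^+ m * n%:R^-1 :> R.
Proof.
move=> n0 /andP[d0 d1] mB.
have k0 : 0 < k`!%:R :> R by rewrite ltr0n fact_gt0.
have nR0 : 0 < n%:R :> R by rewrite ltr0n.
pose bad (y : {ffun 'I_k -> 'I_n}) := [set f : {ffun 'I_m -> 'S_n} |
  (#|[pred i | induces_order y (f i)]|)%:R
    <= (1 - delta) * (k`!)%:R^-1 * m%:R]%SET.
set B := [set f | _]%SET.
have BE : (#|B| <= \sum_(y : {ffun 'I_k -> 'I_n} | injectiveb y) #|bad y|)%N.
  apply: leq_trans (_ : _ <= #|\bigcup_(y : {ffun 'I_k -> 'I_n} | injectiveb y)
    bad y|)%N _; last first.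
    apply: (big_ind2 (fun (A : {set _}) c => #|A| <= c)%N) => //.
      by rewrite cards0.
    move=> A c A' c' Ac Ac'; rewrite (leq_trans _ (leq_add Ac Ac'))//.
    exact: leq_card_setU.
  apply: subset_leq_card; apply/fintype.subsetP => f; rewrite inE.
  move=> /asboolPn/existsNP[y /not_implyP[yinj /negP]].
  rewrite -ltNge prob_of_unif_over => yf.
  apply/finset.bigcupP; exists (finfun y).
    by apply/injectiveP => i j; rewrite !ffunE => /yinj.
  have -> : bad (finfun y) = [set f : {ffun 'I_m -> 'S_n} |
      (#|[pred i | induces_order y (f i)]|)%:R
        <= (1 - delta) * (k`!)%:R^-1 * m%:R]%SET.
    rewrite /bad; apply/setP => g; rewrite !inE; congr (_%:R <= _).
    apply: eq_card => i; rewrite !inE /induces_order.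
    by apply: eq_forallb => a; apply: eq_forallb => b; rewrite !ffunE.
  (* For [m = 0], possible when n = 1, the quotient in [yf] is 0 by convention and cannot be
     cleared; membership in [bad] then reads 0 <= 0. *)
  rewrite inE; have [m0|m0] := posnP m.
    rewrite eq_card0 => [|i]; last by have := ltn_ord i; rewrite {2}m0.
    by rewrite !mulr_ge0 ?invr_ge0// subr_ge0 ltW.
  by rewrite -ler_pdivrMr ?ltr0n// ltW.
have badE (y : {ffun 'I_k -> 'I_n}) : injective y ->
    #|bad y|%:R <= #|{: 'S_n}|%:R ^+ m * (n%:R ^+ k.+1)^-1 :> R.
  move=> yinj.
  have q0 : 0 <= (k`!)%:R^-1 :> R by rewrite invr_ge0 ltW.
  have dd : 0 <= delta <= 1 by rewrite !ltW.
  apply: le_trans (chernoff_lower_tail_card _ _ _ m _ _ q0 dd _) _.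
    by rewrite mulrC ler_pdivrMr// -natrM ler_nat mulnC; exact: card_induces_order.
  rewrite ler_wpM2l ?exprn_ge0//.
  (* With n^(k+1) = exp((k+1) ln n), the claim is [mB] scaled by delta^2 / (2 k!); the factor k+1 is
     (k+1)! / k!. *)
  rewrite -[in leRHS](@lnK _ n%:R) ?posrE// -expRM_natl -expRN ler_expR lerN2.
  have dk : 0 < delta ^+ 2 / (2 * k`!%:R) by rewrite divr_gt0 ?exprn_gt0 ?mulr_gt0.
  have := ler_wpM2l (ltW dk) mB; rewrite factS natrM => h.
  apply: le_trans (le_trans _ h) _.
    rewrite le_eqVlt; apply/orP; left; apply/eqP; field.
    by rewrite !gt_eqF.
  rewrite le_eqVlt; apply/orP; left; apply/eqP; field.
  by rewrite !gt_eqF.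
have : #|B|%:R <= \sum_(y : {ffun 'I_k -> 'I_n} | injectiveb y)
    #|{: 'S_n}|%:R ^+ m * (n%:R ^+ k.+1)^-1 :> R.
  rewrite (@le_trans _ _ (\sum_(y : {ffun 'I_k -> 'I_n} | injectiveb y)
    #|bad y|)%N%:R)// ?ler_nat// natr_sum ler_sum// => y /injectiveP.
  exact: badE.
move=> /le_trans; apply.
(* At most n^k terms, each carrying n^-(k+1), leave 1/n. *)
rewrite sumr_const -[leLHS]mulr_natr -mulrA ler_wpM2l ?exprn_ge0//.
rewrite exprS invfM -mulrA ler_piMr ?invr_ge0// mulrC ler_pdivrMr ?exprn_gt0//.
rewrite mul1r -natrX ler_nat (leq_trans (max_card _))//.
by rewrite card_ffun !card_ord.
Qed.

Theorem mainTheorem7 (R : realType) (k n : nat) (hk : (1 <= k)%N)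
  (hkn : (k <= n)%N) (delta : R) (hdelta0 : 0 < delta) (hdelta1 : delta < 1)
  (xi : nat)
  (hxi : 2 * ((k.+1)`!)%:R / delta ^+ 2 * ln (n%:R : R) <= xi%:R)
  (d : measure_display) (T : measurableType d) (P : probability T R)
  (X : 'I_xi -> {RV P >-> 'S_n})
  (hunif : forall i : 'I_xi, uniform_perm (X i))
  (hindep : mutually_independent X) :
  ((1 - n%:R^-1)%:E <=
    P [set w : T | uniform_induced_ordering k delta
                     (unif_over R [seq X i w | i : 'I_xi])])%E.
Proof.
have n0 : (0 < n)%N := leq_trans hk hkn.
pose B := [set f : {ffun 'I_xi -> 'S_n} | ~~ `[< uniform_induced_ordering k
  delta (unif_over R [seq f i | i : 'I_xi]) >]]%SET.
(* The property depends on [w] only through the tuple of samples, so the event is that this tuple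
   avoids [B]. *)
have -> : [set w : T | uniform_induced_ordering k delta
    (unif_over R [seq X i w | i : 'I_xi])] =
    [set w | [ffun i => X i w] \in finset.setC B].
  apply/funext => w /=; rewrite !inE negbK asboolE.
  rewrite (_ : [seq X i w | i : 'I_xi] =
    [seq [ffun j => X j w] i | i : 'I_xi])//.
  by apply: eq_image => // i; rewrite ffunE.
rewrite iid_uniform_perm_event// lee_fin.
have N0 : 0 < #|{: 'S_n}|%:R ^+ xi :> R.
  by rewrite exprn_gt0// ltr0n card_Sn fact_gt0.
rewrite ler_pdivlMr// finset.cardsCs finset.setCK natrB ?max_card//.
rewrite card_ffun card_ord natrX mulrBl mul1r lerB// mulrC.
by apply: card_not_uniform_induced_ordering; rewrite ?hdelta0.
Qed.
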